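(* Let $M \geq 1$, $s \geq 0$ and $\alpha,\beta \geq 0$. Suppose $X$ is a compact subset of a Banach space $\mathfrak{B}$ such that $X-X$ is $(\alpha,\beta)$-almost $(M,s)$-homogeneous at the origin. Let $\delta > 1$ and let $\mathfrak{B}'$ be another Banach space. Suppose that $\Phi\colon \mathfrak{B}\to\mathfrak{B}'$ is a bounded linear map such that $$\frac{1}{C}\,\frac{\|x-y\|}{\mathrm{slog}(\|x-y\|)^{\delta}} \leq \|\Phi(x)-\Phi(y)\| \leq C\|x-y\|$$ for some positive constant $C$ and for every $x,y\in X$ with $x\neq y$. Then $\Phi(X)-\Phi(X)\subset \mathfrak{B}'$ is $(\alpha+\delta s,\beta)$-almost homogeneous at the origin.
   Context: The symmetric logarithm is $\mathrm{slog}(x) = \log\left(x + \frac1x\right)$ for $x>0$. For a subset $X$ of a normed space, $X-X = \{x-y : x,y\in X\}$, and $B_r(z)$ denotes the closed ball of radius $r$ centred at $z$. For $M>0$, $s\geq 0$, $\alpha,\beta\ge 0$, the set $X-X$ is called $(\alpha,\beta)$-almost $(M,s)$-homogeneous at the origin if for all $0<\rho<r$ there exist finitely many points $z_1,\dots,z_K \in X-X$ such that $$B_r(0)\cap (X-X) \subseteq \bigcup_{i=1}^K B_\rho(z_i), \qquad K \leq M\left(\frac{r}{\rho}\right)^{s} \mathrm{slog}(r)^{\alpha}\,\mathrm{slog}(\rho)^{\beta}.$$ It is called $(\alpha,\beta)$-almost homogeneous at the origin if this holds for some $M>0$ and $s\geq 0$. The same definition applies to $\Phi(X)-\Phi(X)$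 as the difference set of $\Phi(X)\subset\mathfrak{B}'$. *)

(* Defs.v *)
From mathcomp Require Import all_boot all_order all_algebra.
From mathcomp Require Import all_classical all_reals all_analysis.
Set Implicit Arguments.
Unset Strict Implicit.
Unset Printing Implicit Defensive.
Import Order.TTheory GRing.Theory Num.Theory.
Import numFieldNormedType.Exports.
Local Open Scope classical_set_scope.
Local Open Scope ring_scope.

(* Only meaningful for x > 0: at x = 0 the library's conventions 0^-1 = 0 and
   ln 0 = 0 give the junk value 0. *)
Definition slog (R : realType) (x : R) : R := ln (x + x^-1).

Definition diffset (V : zmodType) (X : set V) : set V :=
  [set x - y | x in X & y in X].

(* D plays the role of a difference set X - X. The centres are indexed by 'I_K,
   possibly with repetitions, and K = 0 is allowed (empty D). *)
Definition almost_MS_homogeneous (R : realType) (V : normedModType R)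
    (alpha beta M s : R) (D : set V) : Prop :=
  forall rho r : R, 0 < rho -> rho < r ->
  exists (K : nat) (z : 'I_K -> V),
    [/\ forall i, D (z i),
        closed_ball 0 r `&` D `<=` \bigcup_i closed_ball (z i) rho &
        K%:R <= M * (r / rho) `^ s * slog r `^ alpha * slog rho `^ beta].

Definition almost_homogeneous (R : realType) (V : normedModType R)
    (alpha beta : R) (D : set V) : Prop :=
  exists M s : R, [/\ 0 < M, 0 <= s & almost_MS_homogeneous alpha beta M s D].

(* Main.v *)
Require Import Defs.
From mathcomp Require Import all_boot all_order all_algebra.
From mathcomp Require Import all_classical all_reals all_analysis.
From mathcomp Require Import ring lra.
Set Implicit Arguments.
Unset Strict Implicit.
Unset Printing Implicit Defensive.
Import Order.TTheory GRing.Theory Num.Theory.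
Import numFieldNormedType.Exports.
Local Open Scope classical_set_scope.
Local Open Scope ring_scope.

(* Put t = |x - y|.  The lower bound says t <= C r slog(t)^delta when
   |Phi x - Phi y| <= r.  Since X - X is bounded, either t <= r or
   slog(t) <= a slog(r), so in both cases t <= b r slog(r)^delta.  A cover of
   X - X at this radius with balls of radius rho / c is mapped by Phi to the
   required cover.  As slog is subadditive (slog(x y) <= slog(x) + slog(y)),
   bounded below by ln 2, and slog(slog(r)^delta) <= a' slog(r), the change of
   radii affects the count only through constants and the factor
   slog(r)^(delta s). *)

Section SymmetricLogarithm.
Variable R : realType.
Implicit Types a b d t u x y D : R.

Lemma ln2_gt0 : 0 < ln 2 :> R.
Proof. by apply: ln_gt0; lra. Qed.

Lemma addrV_ge2 x : 0 < x -> 2 <= x + x^-1.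
Proof.
move=> x0; rewrite -(ler_pM2r x0) [leRHS]mulrDl mulVf ?gt_eqF//.
by have := sqr_ge0 (x - 1); rewrite expr2; lra.
Qed.

Lemma addrV_gt0 x : 0 < x -> 0 < x + x^-1.
Proof. by move=> x0; have := addrV_ge2 x0; lra. Qed.

Lemma slog_ge_ln2 x : 0 < x -> ln 2 <= slog x.
Proof.
by move=> x0; rewrite ler_ln ?posrE ?addrV_ge2 ?addrV_gt0//; lra.
Qed.

Lemma slog_gt0 x : 0 < x -> 0 < slog x.
Proof. by move=> x0; exact: lt_le_trans ln2_gt0 (slog_ge_ln2 x0). Qed.

(** Expanding $(x + 1/x)(y + 1/y)$ gives $xy + 1/(xy)$ plus the positive cross terms $x/y$ and
    $y/x$. *)
Lemma slogM x y : 0 < x -> 0 < y -> slog (x * y) <= slog x + slog y.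
Proof.
move=> x0 y0; have xy0 : 0 < x * y by exact: mulr_gt0.
rewrite /slog -lnM ?posrE ?addrV_gt0//.
rewrite ler_ln ?posrE ?mulr_gt0 ?addrV_gt0// invfM.
have : 0 < x * y^-1 by rewrite mulr_gt0 ?invr_gt0.
have : 0 < x^-1 * y by rewrite mulr_gt0 ?invr_gt0.
by rewrite mulrDl !mulrDr; lra.
Qed.

(** With $w = u + 1/u$, both $u^d$ and $u^{-d}$ are at most $w^d$, so their sum is at most $2 w^d$;
    then take logarithms. *)
Lemma slog_powR u d : 0 < u -> 0 <= d -> slog (u `^ d) <= ln 2 + d * slog u.
Proof.
move=> u0 d0; have ud0 : 0 < u `^ d by exact: powR_gt0.
have w0 := addrV_gt0 u0.
rewrite /slog -ln_powR -lnM ?posrE ?powR_gt0//.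
rewrite ler_ln ?posrE ?addrV_gt0 ?mulr_gt0 ?powR_gt0//.
have vp : 0 < u^-1 by rewrite invr_gt0.
have Vu : (u `^ d)^-1 = u^-1 `^ d.
  apply: (mulfI (lt0r_neq0 ud0)).
  by rewrite -powRM ?ltW// !mulfV ?lt0r_neq0// powR1.
rewrite Vu mulr_natl mulr2n lerD// ge0_ler_powR// ?nnegrE; lra.
Qed.

Lemma slog_le_add x : 0 < x -> slog x <= x + x^-1.
Proof. by move=> x0; exact/ltW/ln_sublinear/addrV_gt0. Qed.

(* Since slog >= ln 2, additive constants can be absorbed in a factor. *)
Lemma slog_absorb b t x : 0 <= b -> 0 < x -> t <= b + slog x ->
  t <= (b / ln 2 + 1) * slog x.
Proof.
move=> b0 x0 /le_trans; apply; rewrite mulrDl mul1r lerD2r.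
have l0 := ln2_gt0.
by rewrite mulrAC ler_pdivlMr// ler_wpM2l// slog_ge_ln2.
Qed.

Lemma slog_scale b : 0 < b ->
  exists2 a, 0 < a & forall x, 0 < x -> slog (b * x) <= a * slog x.
Proof.
move=> b0; have sb0 := slog_gt0 b0; exists (slog b / ln 2 + 1).
  by have := divr_gt0 sb0 ln2_gt0; lra.
by move=> x x0; apply: slog_absorb => //; [exact: ltW|exact: slogM].
Qed.

(** After [slog_powR] only [slog (slog x)] remains. The crude bound $\ln w \leq w$ suffices for it:
    with $u$ = [slog x] it gives $u + 1/u \leq u + 1/\ln 2$. *)
Lemma slog_slog_powR d : 0 <= d ->
  exists2 a, 0 < a & forall x, 0 < x -> slog (slog x `^ d) <= a * slog x.
Proof.
move=> d0; have l0 := ln2_gt0; pose k : R := 1 + (ln 2)^-1 / ln 2.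
have k0 : 0 < k.
  have : 0 < (ln 2)^-1 / ln 2 :> R by rewrite divr_gt0 ?invr_gt0.
  rewrite /k; lra.
exists (1 + d * k); first by have := mulr_ge0 d0 (ltW k0); lra.
move=> x x0; have u0 := slog_gt0 x0; have lu := slog_ge_ln2 x0.
apply: (le_trans (slog_powR u0 d0)).
rewrite mulrDl mul1r lerD// -mulrA ler_wpM2l//.
have uV : (slog x)^-1 <= (ln 2)^-1 by rewrite lef_pV2 ?posrE.
rewrite /k addrC; apply: slog_absorb => //; first by rewrite invr_ge0 ltW.
apply: (le_trans (slog_le_add u0)); lra.
Qed.

(** Stands in for monotonicity, which [slog] lacks: $t + 1/t \leq D + 1/r \leq (D + 1)(r + 1/r)$. *)
Lemma slog_le_bounded D t r : 0 <= D -> 0 < r -> r < t -> t <= D ->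
  slog t <= ln (D + 1) + slog r.
Proof.
move=> D0 r0 rt tD; have t0 := lt_trans r0 rt; have D1 : 0 < D + 1 by lra.
rewrite /slog -lnM ?posrE ?addrV_gt0//.
rewrite ler_ln ?posrE ?mulr_gt0 ?addrV_gt0//.
have tr : t^-1 <= r^-1 by rewrite lef_pV2 ?posrE// ltW.
have := ler_wpM2l D0 (addrV_ge2 r0); rewrite mulrDl mul1r; lra.
Qed.

(** Inverts the lower bound on [Phi], with [D] bounding the diameter of [X]. The first inequality on
    [b] will keep the radius used in [X - X] at least [r]. *)
Lemma slog_inverse_bound d C D : 0 <= d -> 0 < C -> 0 <= D ->
  exists b, [/\ 0 < b, forall r, 0 < r -> r <= b * r * slog r `^ d &
    forall r t, 0 < r -> 0 < t -> t <= D -> C^-1 * (t / slog t `^ d) <= r ->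
      t <= b * r * slog r `^ d].
Proof.
move=> d0 C0 D0; have l0 := ln2_gt0.
pose a : R := ln (D + 1) / ln 2 + 1.
have lD : 0 <= ln (D + 1) by apply: ln_ge0; lra.
have a0 : 0 < a by have := divr_ge0 lD (ltW l0); rewrite /a; lra.
have Ca0 : 0 < C * a `^ d by rewrite mulr_gt0 ?powR_gt0.
have ld0 : 0 < (ln 2 `^ d)^-1 :> R by rewrite invr_gt0 powR_gt0.
have small r : 0 < r ->
    r <= (C * a `^ d + (ln 2 `^ d)^-1) * r * slog r `^ d.
  move=> r0; rewrite mulrAC -[leLHS]mul1r ler_wpM2r ?(ltW r0)//.
  have lr : ln 2 `^ d <= slog r `^ d.
    by rewrite ge0_ler_powR ?nnegrE ?slog_ge_ln2// ltW// slog_gt0.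
  have := ler_wpM2l (ltW ld0) lr; rewrite mulVf ?gt_eqF ?powR_gt0//.
  have := mulr_gt0 Ca0 (powR_gt0 d (slog_gt0 r0)).
  by rewrite mulrDl; lra.
(* The second summand serves $t \leq r$, because [slog r] is at least [ln 2]; the first serves $r <
   t$, where [slog t] is at most [a * slog r]. *)
exists (C * a `^ d + (ln 2 `^ d)^-1); split => //; first by lra.
move=> r t r0 t0 tD tr; case: (leP t r) => [/le_trans|rt]; first by apply; exact: small.
have st0 := powR_gt0 d (slog_gt0 t0); have sr0 := slog_gt0 r0.
rewrite ler_pdivrMl// ler_pdivrMr// in tr.
apply: (le_trans tr).
have st : slog t `^ d <= a `^ d * slog r `^ d.
  rewrite -powRM ?(ltW a0) ?(ltW sr0)//.
  rewrite ge0_ler_powR ?nnegrE ?(ltW (slog_gt0 t0)) ?mulr_ge0 ?(ltW a0) ?(ltW sr0)//.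
  by apply: slog_absorb => //; exact: slog_le_bounded.
apply: (@le_trans _ _ (C * a `^ d * r * slog r `^ d)).
  rewrite [leRHS](_ : _ = C * r * (a `^ d * slog r `^ d)); last by ring.
  by rewrite ler_wpM2l// ltW// mulr_gt0.
by rewrite ler_wpM2r ?powR_ge0// ler_wpM2r ?(ltW r0)//; lra.
Qed.

Lemma slog_comp_bound d b : 0 <= d -> 0 < b ->
  exists2 a, 0 < a & forall r, 0 < r -> slog (b * r * slog r `^ d) <= a * slog r.
Proof.
move=> d0 b0; have [a1 a10 h1] := slog_scale b0.
have [a2 a20 h2] := slog_slog_powR d0.
exists (a1 + a2) => [|r r0]; first lra.
apply: (le_trans (slogM _ _)); rewrite ?mulr_gt0 ?powR_gt0 ?slog_gt0//.
by rewrite mulrDl lerD ?h1 ?h2.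
Qed.

(** The extra exponent [delta * s] comes from the ratio of radii: its numerator carries [slog r] to
    the power [delta], and the ratio is raised to the power [s]. *)
Lemma homogeneous_count_bound alpha beta delta s M b c a1 a2 r rho :
  0 <= alpha -> 0 <= beta -> 0 <= s -> 0 <= M ->
  0 < b -> 0 < c -> 0 < a1 -> 0 < a2 -> 0 < r -> 0 < rho ->
  slog (b * r * slog r `^ delta) <= a1 * slog r ->
  slog (c^-1 * rho) <= a2 * slog rho ->
  M * ((b * r * slog r `^ delta) / (c^-1 * rho)) `^ s *
    slog (b * r * slog r `^ delta) `^ alpha * slog (c^-1 * rho) `^ beta <=
  (M * (b * c) `^ s * a1 `^ alpha * a2 `^ beta) *
    (r / rho) `^ s * slog r `^ (alpha + delta * s) * slog rho `^ beta.
Proof.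
move=> al0 be0 s0 M0 b0 c0 a10 a20 r0 rho0 h1 h2.
have L0 := slog_gt0 r0; have Lrho0 := slog_gt0 rho0.
have Ld0 := powR_gt0 delta L0.
have R0 : 0 < b * r * slog r `^ delta by rewrite !mulr_gt0.
have rho'0 : 0 < c^-1 * rho by rewrite mulr_gt0 ?invr_gt0.
have -> : ((b * r * slog r `^ delta) / (c^-1 * rho)) `^ s =
    (b * c) `^ s * (r / rho) `^ s * slog r `^ (delta * s).
  rewrite powRrM -powRM ?ltW ?mulr_gt0 ?invr_gt0//.
  rewrite -powRM ?ltW ?mulr_gt0 ?invr_gt0//.
  by congr (_ `^ s); field; rewrite ?lt0r_neq0.
have {}h1 : slog (b * r * slog r `^ delta) `^ alpha <=
    a1 `^ alpha * slog r `^ alpha.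
  rewrite -powRM ?(ltW a10) ?(ltW L0)//.
  by rewrite ge0_ler_powR ?nnegrE ?mulr_ge0 // ltW ?slog_gt0.
have {}h2 : slog (c^-1 * rho) `^ beta <= a2 `^ beta * slog rho `^ beta.
  rewrite -powRM ?(ltW a20) ?(ltW Lrho0)//.
  by rewrite ge0_ler_powR ?nnegrE ?mulr_ge0 // ltW ?slog_gt0.
rewrite powRD; last by rewrite (lt0r_neq0 L0) implybT.
set Q := M * (_ * _ * _).
have Q0 : 0 <= Q by rewrite !mulr_ge0 ?powR_ge0.
rewrite [leRHS](_ : _ = Q * (a1 `^ alpha * slog r `^ alpha) *
  (a2 `^ beta * slog rho `^ beta)); last by rewrite /Q; ring.
by rewrite ler_pM ?mulr_ge0 ?powR_ge0// ler_wpM2l.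
Qed.

End SymmetricLogarithm.

Lemma compact_diff_bounded (R : realType) (V : normedModType R) (X : set V) :
  compact X -> exists2 D : R, 0 <= D & forall x y, X x -> X y -> `|x - y| <= D.
Proof.
move=> /compact_bounded /pinfty_ex_gt0 [N N0 hN].
exists (N + N) => [|x y Xx Xy]; first lra.
by rewrite (le_trans (ler_normB _ _))// lerD// hN.
Qed.

Theorem lemma2p3 (R : realType) (B B' : completeNormedModType R)
    (M s alpha beta : R) (hM : 1 <= M) (hs : 0 <= s)
    (halpha : 0 <= alpha) (hbeta : 0 <= beta)
    (X : set B) (hXcompact : compact X)
    (hX : almost_MS_homogeneous alpha beta M s (diffset X))
    (delta : R) (hdelta : 1 < delta)
    (Phi : {linear B -> B'}) (hPhi : exists c : R, forall x : B, `|Phi x| <= c * `|x|)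
    (C : R) (hC : 0 < C)
    (hbiLip : forall x y : B, X x -> X y -> x <> y ->
       C^-1 * (`|x - y| / slog `|x - y| `^ delta) <= `|Phi x - Phi y| /\
       `|Phi x - Phi y| <= C * `|x - y|) :
  almost_homogeneous (alpha + delta * s) beta (diffset (Phi @` X)).
Proof.
(* The given bound [c0] may be small or negative. Taking $c \geq 1$ makes [c] invertible and ensures
   $\rho' = \rho / c \leq \rho$. *)
have [c0 hc0] := hPhi; pose c : R := 1 + `|c0|.
have c1 : 1 <= c by rewrite lerDl.
have c_gt0 : 0 < c by lra.
have hc x : `|Phi x| <= c * `|x|.
  rewrite (le_trans (hc0 x))// ler_wpM2r//.
  by have := ler_norm c0; rewrite /c; lra.
have [D D0 hD] := compact_diff_bounded hXcompact.
have d0 : 0 <= delta by lra.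
have [b [b0 hb_ge hb]] := slog_inverse_bound d0 hC D0.
have [a1 a10 h1] := slog_comp_bound d0 b0.
have cV0 : 0 < c^-1 by rewrite invr_gt0.
have [a2 a20 h2] := slog_scale cV0.
exists (M * (b * c) `^ s * a1 `^ alpha * a2 `^ beta), s; split => //.
  by rewrite !mulr_gt0 ?powR_gt0 ?mulr_gt0//; lra.
move=> rho r rho0 rhor; have r0 := lt_trans rho0 rhor.
pose r' := b * r * slog r `^ delta; pose rho' := c^-1 * rho.
have rho'0 : 0 < rho' by rewrite mulr_gt0 ?invr_gt0.
(* The chain is $\rho' \leq \rho < r \leq r'$. *)
have rho'r' : rho' < r'.
  apply: lt_le_trans (hb_ge _ r0); apply: le_lt_trans rhor.
  by rewrite ler_pdivrMl// ler_peMl// ltW.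
have r'0 := lt_trans rho'0 rho'r'.
have [K [z [zX zcover Kle]]] := hX _ _ rho'0 rho'r'.
exists K, (Phi \o z); split.
- move=> i; have [x Xx [y Xy zE]] := zX i.
  exists (Phi x); first by exists x.
  by exists (Phi y); [exists y|rewrite /= -zE linearB].
- move=> w []; rewrite closed_ballE// /closed_ball_ /= sub0r normrN => wr.
  case=> _ [x Xx <-] [_ [y Xy <-]] wE; rewrite -wE -linearB.
  have [i _ xyi] : (\bigcup_i closed_ball (z i) rho') (x - y).
    apply: zcover; split; last by exists x => //; exists y.
    rewrite closed_ballE// /closed_ball_ /= sub0r normrN.
    (* The lower bound on [Phi] is available only for distinct points; if $x = y$ the difference is
       the centre of the ball. *)
    have [->|/eqP xy] := eqVneq x y; first by rewrite subrr normr0 ltW.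
    apply: hb => //; [by rewrite normr_gt0 subr_eq0; apply/eqP|exact: hD|].
    by apply: le_trans wr; rewrite -wE; case: (hbiLip _ _ Xx Xy xy).
  (* By linearity, [Phi] enlarges distances at most by the factor [c], and $c \rho' = \rho$. *)
  exists i => //; move: xyi; rewrite !closed_ballE// /closed_ball_ /= => xyi.
  by rewrite -linearB (le_trans (hc _))// -ler_pdivlMl.
- apply: (le_trans Kle); apply: homogeneous_count_bound => //; first lra.
  + exact: h1.
  + exact: h2.
Qed.
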